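(* Let $A,B,C$ be pairwise disjoint finite sets and let $\mathcal{V}_{AB},\mathcal{V}_{BC}$ be vector spaces over a field $\mathbb{F}$ on $A\uplus B$, $B\uplus C$ respectively. 1. If $\{\mathcal{V}_{AB},\mathcal{V}_{BC}\}$ is rigid then so is $\{\mathcal{M}(\mathcal{V}_{AB}),\mathcal{M}(\mathcal{V}_{BC})\}$. 2. Suppose $\mathcal{M}(\mathcal{V}_{AB}+\mathcal{V}_{BC})=\mathcal{M}(\mathcal{V}_{AB})\vee\mathcal{M}(\mathcal{V}_{BC})$ and $\mathcal{M}(\mathcal{V}_{AB}^{\perp}+\mathcal{V}_{BC}^{\perp})=\mathcal{M}(\mathcal{V}_{AB}^{\perp})\vee\mathcal{M}(\mathcal{V}_{BC}^{\perp})$. Then (a) $\mathcal{M}(\mathcal{V}_{AB}\cap\mathcal{V}_{BC})=\mathcal{M}(\mathcal{V}_{AB})\wedge\mathcal{M}(\mathcal{V}_{BC})$ and $\mathcal{M}(\mathcal{V}_{AB}^{\perp}\cap\mathcal{V}_{BC}^{\perp})=(\mathcal{M}(\mathcal{V}_{AB}))^*\wedge(\mathcal{M}(\mathcal{V}_{BC}))^*$; (b) $\mathcal{M}(\mathcal{V}_{AB}\leftrightarrow\mathcal{V}_{BC})=\mathcal{M}(\mathcal{V}_{AB})\leftrightarrow\mathcal{M}(\mathcal{V}_{BC})$; (c) $\{\mathcal{V}_{AB},\mathcal{V}_{BC}\}$ is rigid iff $\{\mathcal{M}(\mathcal{V}_{AB}),\mathcal{M}(\mathcal{V}_{BC})\}$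 is rigid.
   Context: Vector spaces. A vector on a finite set $X$ over $\mathbb{F}$ is a function $X\to\mathbb{F}$; a space on $X\uplus Y$ carries the subscript $XY$. $\mathcal{F}_X$ is the space of all vectors on $X$, $\mathbf{0}_X$ the zero space; $\mathcal{V}_X^{\perp}=\{g_X:\sum_{e}f(e)g(e)=0\ \forall f_X\in\mathcal{V}_X\}$. For pairwise disjoint $S,P,Q$: $\mathcal{V}_{SP}\circ S=\{f_S:(f_S,f_P)\in\mathcal{V}_{SP}\text{ for some }f_P\}$; $\mathcal{V}_{SP}\times S=\{f_S:(f_S,0_P)\in\mathcal{V}_{SP}\}$; $\mathcal{V}_{SP}+\mathcal{V}_{PQ}=(\mathcal{V}_{SP}\oplus\mathbf{0}_Q)+(\mathbf{0}_S\oplus\mathcal{V}_{PQ})$; $\mathcal{V}_{SP}\cap\mathcal{V}_{PQ}=(\mathcal{V}_{SP}\oplus\mathcal{F}_Q)\cap(\mathcal{F}_S\oplus\mathcal{V}_{PQ})$; $\mathcal{V}_{SP}\leftrightarrow\mathcal{V}_{PQ}=\{(f_S,g_Q):(f_S,h_P)\in\mathcal{V}_{SP},(h_P,g_Q)\in\mathcal{V}_{PQ}\text{ for some }h_P\}$. The pair $\{\mathcal{V}_{AB},\mathcal{V}_{BC}\}$ is rigid iff $\mathcal{V}_{AB}\circ B+\mathcal{V}_{BC}\circ B=\mathcal{F}_B$ and $(\mathcal{V}_{AB}\times B)\cap(\mathcal{V}_{BC}\times B)=\mathbf{0}_B$. Matroids. $\mathcal{M}(\mathcal{V}_X)$ is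 the matroid on $X$ whose independent sets are the sets of columns that are linearly independent in a matrix whose rows form a basis of $\mathcal{V}_X$. $\mathcal{F}_X$ (also) denotes the matroid on $X$ with unique base $X$, $\mathbf{0}_X$ the one with unique base $\emptyset$. $\mathcal{M}\circ T$ is restriction to $T$, $\mathcal{M}\times T=(\mathcal{M}^*\circ T)^*$ contraction to $T$. For matroids on the same set, $\mathcal{M}_1\vee\mathcal{M}_2$ (union) has as bases the maximal sets $b_1\cup b_2$ and $\mathcal{M}_1\wedge\mathcal{M}_2$ has as bases the minimal sets $b_1\cap b_2$, $b_i$ a base of $\mathcal{M}_i$. For pairwise disjoint $S,P,Q$: $\mathcal{M}_{SP}\vee\mathcal{M}_{PQ}=(\mathcal{M}_{SP}\oplus\mathbf{0}_Q)\vee(\mathcal{M}_{PQ}\oplus\mathbf{0}_S)$, $\mathcal{M}_{SP}\wedge\mathcal{M}_{PQ}=(\mathcal{M}_{SP}\oplus\mathcal{F}_Q)\wedge(\mathcal{M}_{PQ}\oplus\mathcal{F}_S)$, $\mathcal{M}_{SP}\leftrightarrow\mathcal{M}_{PQ}=(\mathcal{M}_{SP}\vee\mathcal{M}_{PQ})\times(S\uplus Q)$. The pair $\{\mathcal{M}_{AB},\mathcal{M}_{BC}\}$ is rigid iff $\mathcal{M}_{AB}\circ B\vee\mathcal{M}_{BC}\circ B=\mathcal{F}_B$ and $\mathcal{M}_{AB}\times B\wedge\mathcal{M}_{BC}\times B=\mathbf{0}_B$. Any pair (of vector spaces or matroids) with $B=\emptyset$ is taken to be rigid. *)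

(* Defs.v *)
(* MathComp.  All finite sets are subsets of one ambient finType T.  A matroid *)
(* carries its ground set and is given by its bases; a vector on a subset X of *)
(* T is a function on T that vanishes outside X.                               *)
From HB Require Import structures.
From mathcomp Require Import all_boot all_order all_algebra.
Set Implicit Arguments.
Unset Strict Implicit.
Unset Printing Implicit Defensive.
Import GRing.Theory.

Section Bases.
Variable T : finType.
Implicit Types (X Y : {set T}) (Bs D : {set {set T}}).

Definition is_bases X Bs : bool :=
  [&& Bs != set0, [forall b in Bs, b \subset X] &
      [forall b1 in Bs, forall b2 in Bs, forall x in b1 :\: b2,
        exists y in b2 :\: b1, (y |: (b1 :\ x)) \in Bs]].

Definition maximals D := [set s | maxset (fun t => t \in D) s].
Definition minimals D := [set s | minset (fun t => t \in D) s].

Lemma is_basesP X Bs :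
  reflect [/\ exists b, b \in Bs, forall b, b \in Bs -> b \subset X &
      forall b1 b2 x, b1 \in Bs -> b2 \in Bs -> x \in b1 -> x \notin b2 ->
        exists y, [/\ y \in b2, y \notin b1 & (y |: (b1 :\ x)) \in Bs]]
    (is_bases X Bs).
Proof.
apply: (iffP and3P) => [[/set0Pn ne /forall_inP sub /forall_inP ex] | [ne sub ex]].
  split=> // b1 b2 x b1B b2B xb1 xb2.
  have /forall_inP/(_ b2 b2B)/forall_inP/(_ x) := ex _ b1B.
  rewrite inE xb1 xb2 => /(_ isT)/exists_inP[y].
  by rewrite inE => /andP[yb1 yb2] yB; exists y.
split; [by apply/set0Pn | exact/forall_inP | ].
apply/forall_inP=> b1 b1B; apply/forall_inP=> b2 b2B.
apply/forall_inP=> x; rewrite inE => /andP[xb2 xb1].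
have [y [yb2 yb1 yB]] := ex _ _ _ b1B b2B xb1 xb2.
by apply/exists_inP; exists y; rewrite // inE yb1.
Qed.

Definition augments D := forall I J : {set T}, I \in D -> J \in D ->
  #|I| < #|J| -> exists y, [/\ y \in J, y \notin I & (y |: I) \in D].

Definition lower D := forall I J : {set T}, J \in D -> I \subset J -> I \in D.

Lemma is_bases_maximals X D :
  (exists s, s \in D) -> (forall s, s \in D -> s \subset X) ->
  lower D -> augments D -> is_bases X (maximals D).
Proof.
move=> neD subD low aug; apply/is_basesP; split.
- by case: neD => s /maxset_exists[b maxb _]; exists b; rewrite inE.
- by move=> b; rewrite inE => /maxsetp; apply: subD.
have card b s : b \in maximals D -> s \in D -> #|s| <= #|b|.
  rewrite inE leqNgt => maxb sD; apply/negP=> lt.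
  have [y [ys yb yD]] := aug _ _ (maxsetp maxb) sD lt.
  have := maxsetsup maxb yD (subsetUr _ _) => e.
  by move: yb; rewrite -e setU11.
move=> b1 b2 x b1B b2B xb1 xb2.
have D1 : b1 \in D by move: b1B; rewrite inE => /maxsetp.
have D2 : b2 \in D by move: b2B; rewrite inE => /maxsetp.
have lt : #|b1 :\ x| < #|b2|.
  by apply: leq_trans (card _ _ b2B D1); rewrite (cardsD1 x b1) xb1.
have [y [yb2 yb1 yD]] := aug _ _ (low _ _ D1 (subD1set _ _)) D2 lt.
have nyx : y != x by apply: contraNneq xb2 => <-.
rewrite !inE nyx /= in yb1.
exists y; split=> //; rewrite inE; apply/maxsetP; split=> // s sD sub.
apply/eqP; rewrite eq_sym eqEcard sub (leq_trans (card _ _ b1B sD)) //.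
by rewrite cardsU1 !inE nyx /= yb1 (cardsD1 x b1) xb1.
Qed.

Lemma is_bases_card X Bs b1 b2 :
  is_bases X Bs -> b1 \in Bs -> b2 \in Bs -> #|b1| <= #|b2|.
Proof.
move=> /is_basesP[_ _ ex] b1B b2B.
have [n] := ubnP #|b1 :\: b2|; elim: n b1 b1B => // n IHn b1 b1B lt.
have [/eqP|[x]] := set_0Vmem (b1 :\: b2); first by rewrite setD_eq0 => /subset_leq_card.
rewrite inE => /andP[xb2 xb1].
have [y [yb2 yb1 yB]] := ex _ _ _ b1B b2B xb1 xb2.
have <- : #|y |: b1 :\ x| = #|b1|.
  by rewrite cardsU1 !inE (negPf yb1) andbF (cardsD1 x b1) xb1.
apply: IHn => //; rewrite -ltnS; apply: leq_trans lt; rewrite ltnS proper_card //.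
apply/properP; split; last first.
  exists x; rewrite !inE ?xb1 ?xb2 // eqxx orbF.
  by apply/negP=> /andP[_ /eqP xy]; rewrite xy yb2 in xb2.
apply/subsetP=> z; rewrite !inE => /andP[zb2 /orP[/eqP zy|/andP[_ ->]]].
  by rewrite zy yb2 in zb2.
by rewrite zb2.
Qed.

Definition below Bs := [set I : {set T} | [exists b in Bs, I \subset b]].

Lemma belowP Bs (I : {set T}) :
  reflect (exists2 b, b \in Bs & I \subset b) (I \in below Bs).
Proof. by rewrite inE; apply: exists_inP. Qed.

Lemma lower_below Bs : lower (below Bs).
Proof.
by move=> I J /belowP[b bB sJ] sIJ; apply/belowP; exists b; rewrite ?(subset_trans sIJ).
Qed.

Lemma augments_below X Bs : is_bases X Bs -> augments (below Bs).
Proof.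
move=> isB I J /belowP[bI bIB sI] /belowP[bJ bJB sJ] lt.
have [_ _ ex] := is_basesP _ _ isB.
have [/exists_inP[y]|noaug] := boolP [exists y in J :\: I, y |: I \in below Bs].
  by rewrite inE => /andP[yI yJ] yB; exists y.
have {noaug}no y : y \in J -> y \notin I -> y |: I \notin below Bs.
  move=> yJ yI; apply: contra noaug => yB.
  by apply/exists_inP; exists y; rewrite // inE yI.
have notin b y : b \in Bs -> I \subset b -> y \in J -> y \notin I -> y \notin b.
  move=> bB sb yJ yI; apply: contra (no y yJ yI) => yb.
  by apply/belowP; exists b; rewrite // subUset sub1set yb.
have [n] := ubnP #|bJ :\: (J :|: bI)|.
elim: n bJ bJB sJ => // n IHn bJ bJB sJ ltn.
have [e|[x]] := set_0Vmem (bJ :\: (J :|: bI)); last first.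
  rewrite !inE negb_or => /andP[/andP[xJ xbI] xbJ].
  have [y [ybI ybJ yB]] := ex _ _ _ bJB bIB xbJ xbI.
  apply: IHn yB _ _.
    apply/subsetP=> z zJ; rewrite !inE (subsetP sJ _ zJ) andbT.
    by apply/orP; right; apply: contraNneq xJ => <-.
  rewrite -ltnS; apply: leq_trans ltn; rewrite ltnS proper_card //; apply/properP; split.
    apply/subsetP=> z; rewrite !inE => /andP[zN /orP[/eqP zy|/andP[_ ->]]].
      by rewrite zy ybI orbT in zN.
    by rewrite zN.
  exists x; rewrite !inE ?(negPf xJ) ?(negPf xbI) ?xbJ //= eqxx orbF.
  by apply/eqP=> xy; rewrite -xy xbJ in ybJ.
have sIJ : bI :\: bJ \subset I :\: J.
  apply/subsetP=> x; rewrite !inE => /andP[xbJ xbI].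
  have xJ : x \notin J by apply: contra xbJ; apply: (subsetP sJ).
  rewrite xJ /=; apply: contraT => xI.
  have [y [ybJ ybI yB]] := ex _ _ _ bIB bJB xbI xbJ.
  have yJ : y \in J.
    by have /setP/(_ y) := e; rewrite !inE ybJ (negPf ybI) orbF andbT => /negbFE.
  have yI : y \notin I by apply: contra ybI; apply: (subsetP sI).
  suff sIy : I \subset y |: bI :\ x.
    by have := notin _ y yB sIy yJ yI; rewrite setU11.
  apply/subsetP=> z zI; rewrite !inE (subsetP sI _ zI) andbT.
  by apply/orP; right; apply: contraNneq xI => <-.
have sJI : J :\: I \subset bJ :\: bI.
  apply/subsetP=> y; rewrite !inE => /andP[yI yJ].
  by rewrite (notin _ _ bIB sI yJ yI) (subsetP sJ).
have := leq_trans (subset_leq_card sJI) (leq_trans _ (subset_leq_card sIJ)).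
have c := is_bases_card isB bJB bIB.
have -> : #|bJ :\: bI| <= #|bI :\: bJ|.
  by rewrite -(leq_add2l #|bJ :&: bI|) cardsID setIC cardsID.
move=> /(_ isT); rewrite -(leq_add2l #|J :&: I|) cardsID setIC cardsID.
by rewrite leqNgt lt.
Qed.

Lemma is_basesS X Y Bs : X \subset Y -> is_bases X Bs -> is_bases Y Bs.
Proof.
move=> sXY /is_basesP[ne sub ex]; apply/is_basesP; split=> // b /sub sb.
exact: subset_trans sXY.
Qed.

Lemma is_bases1 X : is_bases X [set X].
Proof.
apply/is_basesP; split; first by exists X; rewrite inE.
  by move=> b /set1P ->.
by move=> b1 b2 x /set1P-> /set1P-> ->.
Qed.

Lemma is_bases_compl X Bs : is_bases X Bs -> is_bases X [set X :\: b | b in Bs].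
Proof.
move=> isB; have [[b0 b0B] sub ex] := is_basesP _ _ isB.
apply/is_basesP; split.
- by exists (X :\: b0); apply: imset_f.
- by move=> _ /imsetP[b _ ->]; apply: subsetDl.
move=> _ _ x /imsetP[b1 b1B ->] /imsetP[b2 b2B ->].
rewrite !inE => /andP[xb1 xX]; rewrite xX andbT negbK => xb2.
have grow n : n < #|b1| -> exists2 I : {set T}, I \in below Bs &
    [/\ x |: (b1 :&: b2) \subset I, I \subset x |: b1 & n < #|I|].
  elim: n => [|n IHn] lt.
    exists (x |: (b1 :&: b2)); last by rewrite subxx setUS ?subsetIl ?cardsU1 ?inE ?(negPf xb1).
    by apply/belowP; exists b2; rewrite // subUset sub1set xb2 subsetIr.
  have [I ID [s1 s2 ltI]] := IHn (ltnW lt).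
  have [lt1|ge1] := ltnP n.+1 #|I|; first by exists I.
  have b1D : b1 \in below Bs by apply/belowP; exists b1.
  have [y [yb1 yI yD]] := augments_below isB ID b1D (leq_ltn_trans ge1 lt).
  exists (y |: I) => //; rewrite (subset_trans s1) ?subsetUr // cardsU1 yI.
  by rewrite subUset sub1set s2 !inE yb1 orbT.
have [|I /belowP[b bB sIb] [s1 s2 cI]] := grow #|b1|.-1.
  rewrite ltn_predL card_gt0; apply: contraTneq xb2 => b10.
  have := is_bases_card isB b2B b1B; rewrite b10 cards0 leqn0 cards_eq0.
  by move=> /eqP->; rewrite inE.
have {}cI : #|b1| <= #|I| := leq_trans (leqSpred _) cI.
have eIb : I = b.
  by apply/eqP; rewrite eqEcard sIb (leq_trans (is_bases_card isB bB b1B)).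
move: s1 s2 cI; rewrite {}eIb {sIb I} => s1 s2 cb.
have xb : x \in b by apply: (subsetP s1); rewrite setU11.
have [y yb1 yb] : exists2 y, y \in b1 & y \notin b.
  apply/subsetPn; apply/negP=> sb.
  have : #|x |: b1| <= #|b| by apply: subset_leq_card; rewrite subUset sub1set xb.
  by rewrite cardsU1 xb1 leqNgt ltnS (is_bases_card isB bB b1B).
have yb2 : y \notin b2.
  by apply: contra yb => yb2; apply: (subsetP s1); rewrite !inE yb1 yb2 orbT.
have yX := subsetP (sub _ b1B) _ yb1.
exists y; rewrite !inE yb1 yb2 yX; split=> //; apply/imsetP; exists b => //.
have eb : b = x |: (b1 :\ y).
  apply/eqP; rewrite eqEcard; apply/andP; split.
    apply/subsetP=> z zb; have nzy : z != y by apply: contraNneq yb => <-.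
    by have := subsetP s2 z zb; rewrite !inE nzy.
  by rewrite cardsU1 !inE (negPf xb1) andbF add1n (leq_trans _ cb) // (cardsD1 y b1) yb1.
rewrite eb; apply/setP=> z; rewrite !inE.
have [->|zx] := eqVneq z x; rewrite /= ?andbF ?orbF.
  by apply/negbTE; apply: contraNneq xb1 => ->.
by case: eqVneq => [->|_] /=; rewrite ?yX.
Qed.

Lemma maximals_below D : maximals (below D) = maximals D.
Proof.
apply/setP=> s; rewrite !inE; apply/maxsetP/maxsetP=> [[/belowP[b bD sb] m]|[sD m]].
  have e : b = s by apply: m => //; apply/belowP; exists b.
  rewrite -{1}e; split=> // t tD; apply: m; apply/belowP; by exists t.
split=> [|t /belowP[b bD tb] st]; first by apply/belowP; exists s.
by apply/eqP; rewrite eqEsubset st andbT -(m b) // (subset_trans st).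
Qed.

Lemma is_bases_union X Bs1 Bs2 : is_bases X Bs1 -> is_bases X Bs2 ->
  is_bases X (maximals [set b1 :|: b2 | b1 in Bs1, b2 in Bs2]).
Proof.
move=> is1 is2; have aug1 := augments_below is1; have aug2 := augments_below is2.
have [[c1 c1B] sub1 _] := is_basesP _ _ is1.
have [[c2 c2B] sub2 _] := is_basesP _ _ is2.
pose E1 := below Bs1; pose E2 := below Bs2.
set D := (X in maximals X); rewrite -maximals_below.
have low1 : lower E1 := @lower_below _; have low2 : lower E2 := @lower_below _.
(* splitting an independent set of the union as a disjoint union *)
have split I : I \in below D -> exists I1 I2,
    [/\ I1 \in E1, I2 \in E2, I1 :|: I2 = I & [disjoint I1 & I2]].
  case/belowP=> _ /imset2P[b1 b2 b1B b2B ->] sI.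
  exists (I :&: b1), (I :\: b1); split.
  - by apply/belowP; exists b1; rewrite ?subsetIr.
  - apply/belowP; exists b2 => //; apply/subsetP=> z; rewrite inE => /andP[zb1 zI].
    by have := subsetP sI z zI; rewrite inE (negPf zb1).
  - exact: setID.
  - by rewrite -setI_eq0; apply/eqP/setP=> z; rewrite !inE; case: (z \in b1); rewrite ?andbF.
have join I1 I2 : I1 \in E1 -> I2 \in E2 -> I1 :|: I2 \in below D.
  move=> /belowP[b1 b1B s1] /belowP[b2 b2B s2]; apply/belowP.
  by exists (b1 :|: b2); [apply: imset2_f | apply: setUSS].
have cardU (I1 I2 : {set T}) : [disjoint I1 & I2] -> #|I1 :|: I2| = #|I1| + #|I2|.
  by move=> d; rewrite cardsU disjoint_setI0 // cards0 subn0.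
apply: is_bases_maximals.
- by exists (c1 :|: c2); apply/belowP; exists (c1 :|: c2); rewrite // imset2_f.
- move=> s /belowP[_ /imset2P[b1 b2 b1B b2B ->] /subset_trans]; apply.
  by rewrite subUset sub1 // sub2.
- exact: lower_below.
move=> I J /split[I1 [I2 [iI1 iI2 eI dI]]] /split[J1 [J2 [iJ1 iJ2 eJ dJ]]].
have [n] := ubnP (#|I1 :&: J2| + #|I2 :&: J1|).
elim: n I1 I2 iI1 iI2 eI dI => // n IHn I1 I2 iI1 iI2 eI dI ltn.
have move1 (A1 A2 C1 C2 : {set T}) y : [disjoint A1 & A2] -> [disjoint C1 & C2] ->
    y \in C1 -> y \in A2 -> #|(y |: A1) :&: C2| + #|(A2 :\ y) :&: C1|
    < #|A1 :&: C2| + #|A2 :&: C1|.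
  move=> dA dC yC1 yA2.
  have -> : (y |: A1) :&: C2 = A1 :&: C2.
    apply/setP=> z; rewrite !inE; case: eqP => //= ->.
    by rewrite (disjointFr dC yC1) andbF.
  rewrite ltn_add2l (cardsD1 y (A2 :&: C1)) inE yA2 yC1 add1n ltnS.
  by rewrite subset_leq_card //; apply/subsetP=> z; rewrite !inE andbA.
have move2 (A1 A2 : {set T}) y : [disjoint A1 & A2] -> y \in A2 ->
    (y |: A1) :|: (A2 :\ y) = A1 :|: A2 /\ [disjoint y |: A1 & A2 :\ y].
  move=> dA yA2; split.
    apply/setP=> z; rewrite !inE; case: eqP => //= ->.
    by rewrite yA2 orbT.
  rewrite -setI_eq0; apply/eqP/setP=> z; rewrite !inE; case: eqP => //= _.
  by have [zA|//] := boolP (z \in A1); rewrite (disjointFr dA zA).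
move=> lt; have := lt; rewrite -{1}eI -{1}eJ !cardU //.
have [lt1 _|ge1] := ltnP #|I1| #|J1|.
  have [y [yJ yI1 yD]] := aug1 _ _ iI1 iJ1 lt1.
  have [yI2|yI2] := boolP (y \in I2).
    have [e d] := move2 _ _ _ dI yI2.
    apply: (IHn (y |: I1) (I2 :\ y)) => //; rewrite ?e //.
      exact: low2 (subD1set _ _).
    by rewrite -ltnS; apply: leq_trans ltn; rewrite ltnS; apply: move1.
  exists y; split; first by rewrite -eJ inE yJ.
    by rewrite -eI inE negb_or yI1.
  by rewrite -eI setUA; apply: join.
move=> lt2; have {}lt2 : #|I2| < #|J2|.
  by rewrite ltnNge; apply/negP=> ge2; rewrite ltnNge leq_add in lt2.
have [y [yJ yI2 yD]] := aug2 _ _ iI2 iJ2 lt2.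
have dI' : [disjoint I2 & I1] by rewrite disjoint_sym.
have dJ' : [disjoint J2 & J1] by rewrite disjoint_sym.
have [yI1|yI1] := boolP (y \in I1).
  have [e d] := move2 _ _ _ dI' yI1.
  apply: (IHn (I1 :\ y) (y |: I2)) => //; rewrite 1?disjoint_sym 1?setUC ?e 1?setUC //.
    exact: low1 (subD1set _ _).
  by rewrite -ltnS; apply: leq_trans ltn; rewrite ltnS addnC [X in _ < X]addnC; apply: move1.
exists y; split; first by rewrite -eJ inE yJ orbT.
  by rewrite -eI inE negb_or yI1.
by rewrite -eI setUCA; apply: join.
Qed.

Lemma is_bases_inter X Bs1 Bs2 : is_bases X Bs1 -> is_bases X Bs2 ->
  is_bases X (minimals [set b1 :&: b2 | b1 in Bs1, b2 in Bs2]).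
Proof.
move=> is1 is2.
have [_ sub1 _] := is_basesP _ _ is1; have [_ sub2 _] := is_basesP _ _ is2.
have := is_bases_compl (is_bases_union (is_bases_compl is1) (is_bases_compl is2)).
set P := [set X :\: b | b in _]; set Q := minimals _; suff -> : P = Q by [].
have invol (b : {set T}) : b \subset X -> X :\: (X :\: b) = b.
  by move=> sb; rewrite setDDr setDv set0U (setIidPr sb).
have inU s : s \in [set b1 :&: b2 | b1 in Bs1, b2 in Bs2] -> s \subset X /\
    X :\: s \in [set b1 :|: b2 | b1 in [set X :\: b | b in Bs1], b2 in [set X :\: b | b in Bs2]].
  case/imset2P=> b1 b2 b1B b2B ->; split; first exact: subset_trans (subsetIl _ _) (sub1 _ b1B).
  by rewrite setDIr; apply: imset2_f; apply: imset_f.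
have inI s : s \in [set b1 :|: b2 | b1 in [set X :\: b | b in Bs1], b2 in [set X :\: b | b in Bs2]] ->
    s \subset X /\ X :\: s \in [set b1 :&: b2 | b1 in Bs1, b2 in Bs2].
  case/imset2P=> _ _ /imsetP[b1 b1B ->] /imsetP[b2 b2B ->] ->.
  rewrite subUset !subsetDl setDUr (invol _ (sub1 _ b1B)) (invol _ (sub2 _ b2B)); split=> //.
  exact: imset2_f.
apply/setP=> s; apply/imsetP/idP.
  case=> b; rewrite inE => /maxsetP[bU m] ->; rewrite inE; apply/minsetP.
  have [sb bI] := inI _ bU; split=> // t tI st.
  have [sX tU] := inU _ tI; rewrite -(invol t sX) (m _ tU) //.
  by rewrite -(invol b sb) setDS.
rewrite inE => /minsetP[sI m]; have [sX sU] := inU _ sI.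
exists (X :\: s); last by rewrite invol.
rewrite inE; apply/maxsetP; split=> // t tU st; have [stX tI] := inI _ tU.
by rewrite -(m _ tI) ?invol // -(invol s sX) setDS.
Qed.

End Bases.

Record matroid (T : finType) := Matroid {
  ground : {set T};
  bases : {set {set T}};
  matroidP : is_bases ground bases
}.

Section Matroids.
Variable T : finType.
Implicit Types (M N : matroid T) (X S : {set T}).

Definition indep M (I : {set T}) : bool := [exists b in bases M, I \subset b].

Lemma mfree_subproof X : is_bases X [set X].
Proof. exact: is_bases1. Qed.
Definition mfree X : matroid T := Matroid (mfree_subproof X).

Lemma mzero_subproof X : is_bases X [set set0].
Proof. exact: is_basesS (sub0set X) (is_bases1 set0). Qed.
Definition mzero X : matroid T := Matroid (mzero_subproof X).

Lemma mdual_subproof M : is_bases (ground M) [set ground M :\: b | b in bases M].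
Proof. exact: is_bases_compl (matroidP M). Qed.
Definition mdual M : matroid T := Matroid (mdual_subproof M).

Lemma mrestr_subproof M S :
  is_bases S (maximals [set I : {set T} | (I \subset S) && indep M I]).
Proof.
have belowE I : indep M I = (I \in below (bases M)) by rewrite inE.
apply: is_bases_maximals.
- have [[b bM] _ _] := is_basesP _ _ (matroidP M).
  by exists set0; rewrite inE sub0set; apply/exists_inP; exists b; rewrite ?sub0set.
- by move=> s; rewrite inE => /andP[].
- move=> I J; rewrite !inE !belowE => /andP[sJ iJ] sIJ.
  by rewrite (subset_trans sIJ sJ) (lower_below iJ sIJ).
move=> I J; rewrite !inE !belowE => /andP[sI iI] /andP[sJ iJ] lt.
have [y [yJ yI yD]] := augments_below (matroidP M) iI iJ lt.
by exists y; rewrite !inE belowE yD subUset sub1set (subsetP sJ) ?sI.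
Qed.
(* For S a subset of ground M. *)
Definition mrestr M S : matroid T := Matroid (mrestr_subproof M S).

Definition mcontr M S : matroid T := mdual (mrestr (mdual M) S).

Lemma munion_subproof M N : is_bases (ground M :|: ground N)
  (maximals [set b1 :|: b2 | b1 in bases M, b2 in bases N]).
Proof.
apply: is_bases_union.
  exact: is_basesS (subsetUl _ _) (matroidP M).
exact: is_basesS (subsetUr _ _) (matroidP N).
Qed.
(* Union, for ground M = ground N. *)
Definition munion M N : matroid T := Matroid (munion_subproof M N).

Lemma minter_subproof M N : is_bases (ground M :|: ground N)
  (minimals [set b1 :&: b2 | b1 in bases M, b2 in bases N]).
Proof.
apply: is_bases_inter.
  exact: is_basesS (subsetUl _ _) (matroidP M).
exact: is_basesS (subsetUr _ _) (matroidP N).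
Qed.
(* Intersection, for ground M = ground N. *)
Definition minter M N : matroid T := Matroid (minter_subproof M N).

(* Direct sum, for disjoint ground sets: every b1 :|: b2 is then maximal. *)
Definition mdsum M N : matroid T := Matroid (munion_subproof M N).

Lemma bases_mdsum M N : [disjoint ground M & ground N] ->
  bases (mdsum M N) = [set b1 :|: b2 | b1 in bases M, b2 in bases N].
Proof.
move=> dMN; apply/setP=> s; rewrite inE; apply/idP/idP => [/maxsetp //|sD].
apply/maxsetP; split=> // t tD st; apply/eqP; rewrite eq_sym eqEcard st.
have [_ subM _] := is_basesP _ _ (matroidP M).
have [_ subN _] := is_basesP _ _ (matroidP N).
case/imset2P: sD => b1 b2 b1M b2N ->; case/imset2P: tD => c1 c2 c1M c2N ->.
have d b c : b \in bases M -> c \in bases N -> #|b :|: c| = #|b| + #|c|.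
  move=> bM cN; rewrite cardsU disjoint_setI0 ?cards0 ?subn0 //.
  exact: disjointW (subM _ bM) (subN _ cN) dMN.
rewrite !d //; apply: leq_add; first exact: is_bases_card (matroidP M) _ _.
exact: is_bases_card (matroidP N) _ _.
Qed.

(* For ground M = S + P and ground N = P + Q (disjoint sums), S and Q are     *)
(* recovered as the differences of the two ground sets.                       *)
Definition mvee M N : matroid T :=
  munion (mdsum M (mzero (ground N :\: ground M)))
         (mdsum N (mzero (ground M :\: ground N))).

Definition mwedge M N : matroid T :=
  minter (mdsum M (mfree (ground N :\: ground M)))
         (mdsum N (mfree (ground M :\: ground N))).

Definition mmatch M N : matroid T :=
  mcontr (mvee M N)
    ((ground M :\: ground N) :|: (ground N :\: ground M)).

(* ground M and ground N meet in B; pairs with B empty are rigid by convention. *)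
Definition mrigid (B : {set T}) M N : Prop :=
  B = set0 \/
  munion (mrestr M B) (mrestr N B) = mfree B /\
  minter (mcontr M B) (mcontr N B) = mzero B.

End Matroids.

Section Spaces.
Local Open Scope ring_scope.
Variables (F : fieldType) (T : finType).

(* A vector on X is extended by zero to the whole of T, so that direct sums   *)
(* with a zero space leave a space unchanged and the extended sum of spaces   *)
(* on S + P and P + Q is the sum of subspaces.                                *)
Local Notation vec := {ffun T -> F^o}.
Implicit Types (X S P Q B : {set T}) (U V W : {vspace vec}) (f g h : vec).

Definition vrestr_fun X f : vec := [ffun e => if e \in X then f e else 0].

Lemma vrestr_is_linear X : linear (vrestr_fun X).
Proof.
move=> a f g; apply/ffunP=> e; rewrite !ffunE.
by case: ifP => _ //; rewrite scaler0 addr0.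
Qed.
HB.instance Definition _ X :=
  GRing.isLinear.Build F vec vec *:%R (vrestr_fun X) (vrestr_is_linear X).

Definition vrestr X : 'End(vec) := linfun (vrestr_fun X).

Lemma vrestrE X f e : vrestr X f e = if e \in X then f e else 0.
Proof. by rewrite lfunE ffunE. Qed.

Definition vfull X : {vspace vec} := fixedSpace (vrestr X).

Lemma vfullP X f : reflect (forall e, e \notin X -> f e = 0) (f \in vfull X).
Proof.
apply: (iffP fixedSpaceP) => [<- e /negPf eX | f0].
  by rewrite vrestrE eX.
by apply/ffunP=> e; rewrite vrestrE; case: ifPn => // /f0.
Qed.

Definition pairing_fun V g : {ffun 'I_(\dim V) -> F^o} :=
  [ffun i : 'I_(\dim V) => \sum_e (vbasis V)`_i e * g e].

Lemma pairing_is_linear V : linear (pairing_fun V).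
Proof.
move=> a g h; apply/ffunP=> i; rewrite !ffunE scaler_sumr -big_split /=.
by apply: eq_bigr => e _; rewrite !ffunE mulrDr scalerAr.
Qed.
HB.instance Definition _ V := GRing.isLinear.Build F vec
  {ffun 'I_(\dim V) -> F^o} *:%R (pairing_fun V) (pairing_is_linear V).

Definition vperp X V : {vspace vec} :=
  (vfull X :&: lker (linfun (pairing_fun V)))%VS.

Lemma vperpP X V g : reflect
  (g \in vfull X /\ forall f, f \in V -> \sum_(e in X) f e * g e = 0)
  (g \in vperp X V).
Proof.
rewrite memv_cap memv_ker lfunE; apply: (iffP andP).
  move=> [gX /eqP/ffunP orth]; split=> // f fV.
  rewrite (coord_vbasis fV) big_mkcond /=.
  transitivity (\sum_i coord (vbasis V) i f * \sum_e (vbasis V)`_i e * g e).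
    under [RHS]eq_bigr do rewrite mulr_sumr.
    rewrite exchange_big; apply: eq_bigr => e _ /=.
    case: ifPn => [_ | /(vfullP _ _ gX) ->]; last first.
      by rewrite big1 // => i _; rewrite !mulr0.
    rewrite sum_ffunE mulr_suml; apply: eq_bigr => i _.
    by rewrite ffunE mulrA.
  by rewrite big1 // => i _; have := orth i; rewrite !ffunE => ->; rewrite mulr0.
move=> [gX orth]; split=> //; apply/eqP/ffunP=> i; rewrite !ffunE.
rewrite -[RHS](orth (vbasis V)`_i) ?vbasis_mem ?mem_nth ?size_tuple //.
rewrite [RHS]big_mkcond; apply: eq_bigr => e _ /=.
by case: ifPn => // /(vfullP _ _ gX) ->; rewrite mulr0.
Qed.

Definition vres S V : {vspace vec} := (vrestr S @: V)%VS.

Definition vcontr S V : {vspace vec} := (V :&: vfull S)%VS.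

(* Here U is on S + P and V on P + Q. *)
Definition vinter S Q U V : {vspace vec} :=
  ((U + vfull Q) :&: (vfull S + V))%VS.

Definition vmatch S Q U V : {vspace vec} := vres (S :|: Q) (vinter S Q U V).

Lemma vmatchP S P Q U V k :
  [disjoint S & P] -> [disjoint P & Q] -> [disjoint S & Q] ->
  (U <= vfull (S :|: P))%VS -> (V <= vfull (P :|: Q))%VS ->
  reflect (exists f g h, [/\ f \in vfull S, h \in vfull P & g \in vfull Q] /\
             [/\ f + h \in U, h + g \in V & k = f + g])
    (k \in vmatch S Q U V).
Proof.
move=> dSP dPQ dSQ sU sV; apply: (iffP memv_imgP) => [[w] | ].
  rewrite memv_cap => /andP[/memv_addP[u uU [q qQ ->]] /memv_addP[s sS [v vV e]] ->].
  have u0 := vfullP _ _ (subvP sU _ uU); have v0 := vfullP _ _ (subvP sV _ vV).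
  have q0 := vfullP _ _ qQ; have s0 := vfullP _ _ sS.
  exists (vrestr S u), (vrestr Q v), (vrestr P u).
  have inX X f : vrestr X f \in vfull X.
    by apply/vfullP=> z /negPf zX; rewrite vrestrE zX.
  have ez z : u z + q z = s z + v z.
    by have /ffunP/(_ z) := e; rewrite !ffunE.
  have uP z : z \in P -> u z = v z.
    move=> zP; have := ez z.
    by rewrite q0 ?s0 ?(disjointFl dSP zP) ?(disjointFr dPQ zP) // addr0 add0r.
  have qv z : z \in Q -> q z = v z.
    move=> zQ; have := ez z.
    rewrite u0 ?s0 ?inE ?(disjointFl dSQ zQ) ?(disjointFl dPQ zQ) //.
    by rewrite !add0r.
  split; first by [].
  split.
  - suff -> : vrestr S u + vrestr P u = u by [].
    apply/ffunP=> z; rewrite ffunE !vrestrE.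
    case: ifPn => zS; first by rewrite (disjointFr dSP zS) addr0.
    by case: ifPn => zP; rewrite add0r // u0 // inE negb_or zS.
  - suff -> : vrestr P u + vrestr Q v = v by [].
    apply/ffunP=> z; rewrite ffunE !vrestrE.
    case: ifPn => zP; first by rewrite (disjointFr dPQ zP) addr0 uP.
    by case: ifPn => zQ; rewrite add0r // v0 // inE negb_or zP.
  - apply/ffunP=> z; rewrite ffunE !vrestrE inE ffunE.
    case: (boolP (z \in S)) => /= zS; first by rewrite q0 (disjointFr dSQ zS).
    case: ifPn => zQ; last by rewrite addr0.
    by rewrite -qv // u0 // inE negb_or zS (disjointFl dPQ zQ).
move=> [f [g [h [[fS hP gQ] [fhU hgV ->]]]]]; exists (f + h + g).
  rewrite memv_cap memv_add //= -addrA memv_add //.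
apply/ffunP=> z; rewrite vrestrE !ffunE inE.
case: ifPn => [zSQ | ]; last first.
  rewrite negb_or => /andP[zS zQ].
  by rewrite (vfullP _ _ fS _ zS) (vfullP _ _ gQ _ zQ) addr0.
rewrite (vfullP _ _ hP z) ?addr0 //.
by case/orP: zSQ => zz; rewrite ?(disjointFr dSP zz) ?(disjointFl dPQ zz).
Qed.

(* U and V live on ground sets meeting in B. *)
Definition vrigid B U V : Prop :=
  B = set0 \/
  (vres B U + vres B V)%VS = vfull B /\
  (vcontr B U :&: vcontr B V)%VS = 0%VS.

(* The column at e of the matrix whose rows are the vectors of vbasis V; the  *)
(* choice of basis does not affect linear (in)dependence of columns.          *)
Definition vcol V (e : T) : 'cV[F]_(\dim V) := \col_(i < \dim V) (vbasis V)`_i e.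

Definition col_free V (I : {set T}) : bool :=
  free [seq vcol V e | e <- enum I].

Lemma col_freeU1 V (I : {set T}) y : y \notin I ->
  col_free V (y |: I) =
  (vcol V y \notin <<[seq vcol V e | e <- enum I]>>%VS) && col_free V I.
Proof.
move=> yI; rewrite /col_free -free_cons -map_cons; apply/perm_free/perm_map.
apply: uniq_perm; rewrite ?enum_uniq //= ?mem_enum ?yI ?enum_uniq // => z.
by rewrite !(inE, mem_enum).
Qed.

Lemma col_freeS V (I J : {set T}) : I \subset J -> col_free V J -> col_free V I.
Proof.
move=> sIJ; rewrite /col_free.
have /(perm_map (vcol V))/perm_free-> : perm_eq (enum J) (enum I ++ enum (J :\: I)).
  apply: uniq_perm; rewrite ?cat_uniq ?enum_uniq //=.
    by rewrite andbT; apply/hasPn=> z; rewrite !mem_enum inE => /andP[].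
  move=> z; rewrite mem_cat !mem_enum inE.
  by have := subsetP sIJ z; case: (z \in I) => //= ->.
by rewrite map_cat => /catl_free.
Qed.

Lemma vmatroid_subproof X V :
  is_bases X (maximals [set I : {set T} | (I \subset X) && col_free V I]).
Proof.
apply: is_bases_maximals.
- by exists set0; rewrite inE sub0set /col_free enum_set0 nil_free.
- by move=> s; rewrite inE => /andP[].
- move=> I J; rewrite !inE => /andP[sJ fJ] sIJ.
  by rewrite (subset_trans sIJ) // (col_freeS sIJ).
move=> I J; rewrite !inE => /andP[sI fI] /andP[sJ fJ] lt.
have [/exists_inP[y yJ /andP[yI yD]]|no] :=
  boolP [exists y in J, (y \notin I) && col_free V (y |: I)].
  by exists y; rewrite !inE yD subUset sub1set (subsetP sJ) ?sI.
have sub : (<<[seq vcol V e | e <- enum J]>>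
            <= <<[seq vcol V e | e <- enum I]>>)%VS.
  apply/span_subvP=> _ /mapP[y + ->]; rewrite mem_enum => yJ.
  have [yI|yI] := boolP (y \in I); first by rewrite memv_span ?map_f ?mem_enum.
  apply: contraR no => ysp; apply/exists_inP; exists y => //.
  by rewrite yI col_freeU1 // ysp.
have := leq_trans (dimvS sub) (dim_span _).
by rewrite (eqP fJ) !size_map -!cardE leqNgt lt.
Qed.
(* The matroid of V, for V a space on X. *)
Definition vmatroid X V : matroid T := Matroid (vmatroid_subproof X V).

End Spaces.

Arguments vfull F [T] X.

(* Main.v *)
Require Import Defs.
From Stdlib Require Import Classical.
From mathcomp Require Import all_boot all_order all_algebra.
Import GRing.Theory.

(** Both kinds of rigidity are statements about the independence of the single
    set [B], and this reduces the theorem to comparing independent sets.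

    For spaces, put U = V_AB and V = V_BC, with complementary orthogonal spaces
    U' and V'.  A set [I] is independent in the matroid of a space W iff no
    nonzero vector supported in [I] is orthogonal to W ([col_freeE]), iff the
    restriction of W to [I] is the full space ([col_free_vres]).  Hence the
    first rigidity condition says that [B] is independent in M(U + V), and the
    second, after passing to orthogonal spaces, that [B] is independent in
    M(U' + V') ([vrigidP]).  For matroids the first condition says that [B] is
    independent in the union of M(U) and M(V), and the second, by duality, that [B]
    is independent in the union of the dual matroids ([mrigidP]).

    Rigid spaces give rigid matroids because every independent set of M(U + V)
    is independent in the union of M(U) and M(V) ([col_free_split]).  In
    orthogonal terms this says that two spaces P and Q meeting in 0 admit a set
    [a] such that P has no nonzero vector supported in [a] and Q none supported
    outside [a] ([disjoint_split]); such a set is built one element at a time.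
    It plays the part of the Laplace expansion of a determinant.

    When the matroids of the two sums are the two unions, the two rigidity
    conditions coincide literally.  The remaining identities follow from the
    duality M(W)* = M(W') ([mdual_vmatroid]): intersections are dual to sums
    for spaces ([vinter_vperp]) and to unions for matroids ([mdual_mvee]), while
    the matching of U and V is, up to the signs of the coordinates in [C], the
    contraction of U + V to [A :|: C] ([vmatroid_vmatch]), and signs do not
    affect the matroid ([vmatroid_scale]). *)

(** * Independent sets, duality and union of matroids *)

Section MatroidFacts.
Set Implicit Arguments.
Unset Strict Implicit.
Variable T : finType.
Implicit Types (M N : matroid T) (X B I J K : {set T}).

Lemma setDDK X I : I \subset X -> X :\: (X :\: I) = I.
Proof. by move=> sIX; rewrite setDDr setDv set0U (setIidPr sIX). Qed.

(** The third field of a matroid is a boolean fact, hence proof irrelevant. *)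
Lemma matroid_eq M N : ground M = ground N -> bases M = bases N -> M = N.
Proof.
case: M N => [X Bs HM] [Y Cs HN] /= eXY eBC; subst Y Cs.
by congr Matroid; apply: bool_irrelevance.
Qed.

Lemma basis_sub M b : b \in bases M -> b \subset ground M.
Proof. by case/is_basesP: (matroidP M) => _ + _; apply. Qed.

Lemma basis_max M b I : b \in bases M -> indep M I -> b \subset I -> I = b.
Proof.
move=> bM /exists_inP[c cM sIc] sbI; apply/eqP; rewrite eq_sym eqEcard sbI.
exact: leq_trans (subset_leq_card sIc) (is_bases_card (matroidP M) cM bM).
Qed.

Lemma indep_basis M b : b \in bases M -> indep M b.
Proof. by move=> bM; apply/exists_inP; exists b. Qed.

(** Bases are recovered as the maximal independent sets, all of one
    cardinality, so the independence predicate determines the matroid. *)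
Lemma matroid_indep_eq M N :
  ground M = ground N -> (forall I, indep M I = indep N I) -> M = N.
Proof.
move=> eg ei.
have sub (P Q : matroid T) b : (forall I, indep P I = indep Q I) ->
    b \in bases P -> b \in bases Q.
  move=> e bP; have := indep_basis bP; rewrite e => /exists_inP[c cQ sbc].
  by rewrite -(basis_max bP (I := c)) // e indep_basis.
by apply: matroid_eq => //; apply/setP=> b; apply/idP/idP; apply: sub.
Qed.

Lemma sub_maximals (D : {set {set T}}) I : lower D ->
  [exists b in maximals D, I \subset b] = (I \in D).
Proof.
move=> low; apply/exists_inP/idP => [[b] | ID].
  by rewrite inE => /maxsetp bD; apply: low.
by have [b mb sIb] := maxset_exists (P := fun t => t \in D) ID; exists b; rewrite ?inE.
Qed.

Lemma indep_mfree X I : indep (mfree X) I = (I \subset X).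
Proof.
apply/exists_inP/idP => [[b /set1P->] // | sIX].
by exists X; rewrite ?inE.
Qed.

Lemma indep_mzero X I : indep (mzero X) I = (I == set0).
Proof.
apply/exists_inP/idP => [[b /set1P->] | /eqP->]; first by rewrite subset0.
by exists set0; rewrite ?inE.
Qed.

Lemma indep_mrestr M B I : indep (mrestr M B) I = (I \subset B) && indep M I.
Proof.
rewrite /indep /= sub_maximals ?inE // => J K.
rewrite !inE => /andP[sKB /exists_inP[b bM sKb]] sJK.
rewrite (subset_trans sJK sKB); apply/exists_inP; exists b => //.
exact: subset_trans sJK sKb.
Qed.

(** A subset of a maximal union [b :|: c] is the union of its traces on [b] and
    on [c], and conversely such unions extend to a maximal one. *)
Lemma indep_munionP M N K :
  reflect (exists I J, [/\ indep M I, indep N J & I :|: J = K])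
          (indep (munion M N) K).
Proof.
rewrite /indep /= -maximals_below sub_maximals; last exact: lower_below.
apply: (iffP (belowP _ _)) => [[_ /imset2P[b c bM cN ->] sK] | ].
  exists (K :&: b), (K :&: c); rewrite -setIUr (setIidPl sK); split=> //.
    by apply/exists_inP; exists b; rewrite ?subsetIr.
  by apply/exists_inP; exists c; rewrite ?subsetIr.
move=> [I [J [/exists_inP[b bM sI] /exists_inP[c cN sJ] <-]]].
by exists (b :|: c); [apply: imset2_f | apply: setUSS].
Qed.

(** The elements added by [mzero] are loops and do not affect independence. *)
Lemma indep_mveeP M N K :
  reflect (exists I J, [/\ indep M I, indep N J & I :|: J = K])
          (indep (mvee M N) K).
Proof.
have loops (P : matroid T) X I : indep (mdsum P (mzero X)) I = indep P I.
  apply/(indep_munionP P (mzero X))/idP => [[J [L [iJ]]] | iI].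
    by rewrite indep_mzero => /eqP-> <-; rewrite setU0.
  by exists I, set0; rewrite indep_mzero setU0.
apply: (iffP (indep_munionP _ _ _)) => -[I [J [iI iJ eK]]]; exists I, J.
  by move: iI iJ; rewrite !loops.
by rewrite !loops.
Qed.

Lemma mdualK M : mdual (mdual M) = M.
Proof.
apply: matroid_eq => //=; rewrite -imset_comp -[RHS]imset_id.
by apply: eq_in_imset => b /basis_sub sb /=; rewrite setDDK.
Qed.

Lemma mem_mdual M (s : {set T}) : s \subset ground M ->
  (s \in bases (mdual M)) = (ground M :\: s \in bases M).
Proof.
move=> ss; apply/imsetP/idP => [[b bM ->] | sM].
  by rewrite setDDK ?basis_sub.
by exists (ground M :\: s); rewrite ?setDDK.
Qed.

Lemma mdual_mfree X : mdual (mfree X) = mzero X.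
Proof. by apply: matroid_eq => //=; rewrite imset_set1 setDv. Qed.

(** De Morgan on bases: complementing exchanges the sets [b :|: c] with the
    intersections of complements, and maximal members with minimal ones. *)
Lemma mdual_munion M N : ground M = ground N ->
  mdual (munion M N) = minter (mdual M) (mdual N).
Proof.
move=> eg; set X := ground M.
have sM b : b \in bases M -> b \subset X by apply: basis_sub.
have sN b : b \in bases N -> b \subset X by rewrite /X eg; apply: basis_sub.
have eX : X :|: ground N = X by rewrite -eg setUid.
apply: matroid_eq => //; apply/setP => s.
pose U := [set b :|: c | b in bases M, c in bases N].
pose V := [set b :&: c | b in bases (mdual M), c in bases (mdual N)].
have sU t : t \in U -> t \subset X.
  by case/imset2P=> b c bM cN ->; rewrite subUset sM ?sN.
have sV t : t \in V -> t \subset X.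
  case/imset2P=> b c /basis_sub/= sb _ ->; exact: subset_trans (subsetIl _ _) sb.
have UV t : t \in U -> X :\: t \in V.
  case/imset2P=> b c bM cN ->; rewrite setDUr.
  apply: (@imset2_f _ _ {set T} (fun b c => b :&: c)); first exact: imset_f.
  by rewrite /= -eg imset_f.
have VU t : t \in V -> X :\: t \in U.
  case/imset2P=> _ _ /imsetP[b bM ->] /imsetP[c cN ->] ->.
  rewrite -eg -/X setDIr (setDDK (sM b bM)) (setDDK (sN c cN)).
  by apply: (@imset2_f _ _ {set T} (fun b c => b :|: c)).
change ((s \in bases (mdual (munion M N))) = (s \in minimals V)).
have [sX|nsX] := boolP (s \subset X); last first.
  apply/idP/idP => [/basis_sub | ]; first by rewrite /= eX (negPf nsX).
  by rewrite inE => /minsetp/sV; rewrite (negPf nsX).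
rewrite mem_mdual /= eX // !inE.
apply/maxsetP/minsetP => [[sU' m] | [sV' m]]; split.
- by rewrite -(setDDK sX) UV.
- move=> t tV sts; have := m _ (VU t tV) (setDS _ sts).
  by move=> /(congr1 (setD X)); rewrite !setDDK // sV.
- exact: VU.
- move=> t tU sst; rewrite -(m _ (UV t tU)) ?setDDK ?sU //.
  by rewrite -(setDDK sX) setDS.
Qed.

Lemma mdual_mdsum_mzero M X : [disjoint ground M & X] ->
  mdual (mdsum M (mzero X)) = mdsum (mdual M) (mfree X).
Proof.
move=> d; apply: matroid_eq => //; rewrite [RHS]bases_mdsum //.
change ([set (ground M :|: X) :\: b | b in bases (mdsum M (mzero X))] =
  [set b :|: c | b in bases (mdual M), c in bases (mfree X)]).
rewrite bases_mdsum //.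
have shift b : b \in bases M ->
    (ground M :|: X) :\: (b :|: set0) = (ground M :\: b) :|: X.
  move=> bM; rewrite setU0 setDUl; congr (_ :|: _); apply/setDidPl.
  by rewrite disjoint_sym; apply: disjointWl d; apply: basis_sub.
apply/setP=> s; apply/imsetP/imset2P => [[_ /imset2P[b c bM /set1P-> ->] ->] | ].
  by exists (ground M :\: b) X; rewrite ?inE ?shift ?imset_f.
case=> _ _ /imsetP[b bM ->] /set1P-> ->; exists (b :|: set0); last by rewrite shift.
by apply: imset2_f; rewrite ?inE.
Qed.

Lemma mdual_mvee M N : mdual (mvee M N) = mwedge (mdual M) (mdual N).
Proof.
rewrite /mvee mdual_munion; last by apply/setP=> x; rewrite !inE /=; do 2 case: (_ \in _).
have dis (P Q : matroid T) : [disjoint ground P & ground Q :\: ground P].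
  by rewrite -setI_eq0; apply/eqP/setP=> x; rewrite !inE; case: (x \in ground P).
by rewrite !mdual_mdsum_mzero.
Qed.

(** Restricting to [B] keeps exactly the independent sets inside [B], so both
    sides say that [B] is covered by an independent set of each matroid. *)
Lemma munion_mrestr_free M N B :
  munion (mrestr M B) (mrestr N B) = mfree B <-> indep (mvee M N) B.
Proof.
split=> [e | /indep_mveeP[I [J [iI iJ eB]]]].
  have : indep (mfree B) B by rewrite indep_mfree.
  rewrite -e => /indep_munionP[I [J []]]; rewrite !indep_mrestr.
  by case/andP=> _ iI /andP[_ iJ] eB; apply/indep_mveeP; exists I, J.
have iB : indep (munion (mrestr M B) (mrestr N B)) B.
  apply/indep_munionP; exists I, J; rewrite !indep_mrestr iI iJ -{1 2}eB.
  by rewrite subsetUl subsetUr.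
apply: matroid_indep_eq => [|K]; first exact: setUid.
rewrite indep_mfree; apply/idP/idP => [/exists_inP[b /basis_sub] | sKB].
  by rewrite /= setUid => sb /subset_trans; apply.
case/exists_inP: iB => b bB sBb; apply/exists_inP; exists b => //.
exact: subset_trans sBb.
Qed.

(** The contraction condition is the dual of a restriction condition, as
    [mcontr M B] is by definition the dual of [mrestr (mdual M) B]; matroid
    rigidity thus consists of the same condition for the pair and for its dual. *)
Lemma mrigidP B M N : mrigid B M N <->
  B = set0 \/ indep (mvee M N) B /\ indep (mvee (mdual M) (mdual N)) B.
Proof.
have minterE : minter (mcontr M B) (mcontr N B) = mzero B <->
    indep (mvee (mdual M) (mdual N)) B.
  rewrite -munion_mrestr_free -mdual_mfree -mdual_munion //.
  by split=> [/(congr1 (@mdual T)) | ->] //; rewrite !mdualK.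
by rewrite /mrigid munion_mrestr_free minterE.
Qed.

End MatroidFacts.

(** * Orthogonality and the matroid of a space *)

Section SpaceFacts.
Set Implicit Arguments.
Unset Strict Implicit.
Local Open Scope ring_scope.
Variables (F : fieldType) (T : finType).
Local Notation vec := {ffun T -> F^o}.
Implicit Types (A B C X Y S I J : {set T}) (U V W P Q : {vspace vec}) (f g h : vec).

Definition unitv (e : T) : vec := [ffun x => (x == e)%:R].

Lemma vspace0P V : reflect (forall f, f \in V -> f = 0) (V == 0%VS).
Proof.
rewrite -subv0; apply: (iffP subvP) => [s f /s | s f /s ->]; last exact: mem0v.
by rewrite memv0 => /eqP.
Qed.

Lemma mem_vcontr X V f : (f \in vcontr X V) = (f \in V) && (f \in vfull F X).
Proof. exact: memv_cap. Qed.

Lemma vfullS X Y : X \subset Y -> (vfull F X <= vfull F Y)%VS.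
Proof.
move=> sXY; apply/subvP=> f /vfullP f0; apply/vfullP=> e eY; apply: f0.
by apply: contra eY; apply: (subsetP sXY).
Qed.

Lemma vrestr_full X f : vrestr F X f \in vfull F X.
Proof. by apply/vfullP=> e /negPf eX; rewrite vrestrE eX. Qed.

Lemma unitv_full X e : e \in X -> unitv e \in vfull F X.
Proof.
by move=> eX; apply/vfullP=> x xX; rewrite ffunE; case: eqP xX => // ->; rewrite eX.
Qed.

Lemma vec_unitv f : f = \sum_e f e *: unitv e.
Proof.
apply/ffunP=> x; rewrite sum_ffunE (bigD1 x) //= big1 => [|e /negPf nex].
  by rewrite !ffunE eqxx addr0 [_ *: _]mulr1.
by rewrite !ffunE eq_sym nex [_ *: _]mulr0.
Qed.

Lemma vperp_sub X V : (vperp X V <= vfull F X)%VS.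
Proof. exact: capvSl. Qed.

Lemma vperpD X U V : vperp X (U + V)%VS = (vperp X U :&: vperp X V)%VS.
Proof.
apply/vspaceP=> g; rewrite memv_cap; apply/vperpP/andP.
  move=> [gX gUV]; split; apply/vperpP; split=> // f fW; apply: gUV.
    by rewrite -[f]addr0 memv_add ?mem0v.
  by rewrite -[f]add0r memv_add ?mem0v.
case=> /vperpP[gX gU] /vperpP[_ gV]; split=> // _ /memv_addP[u uU [v vV ->]].
under eq_bigr => e _ do rewrite ffunE mulrDl.
by rewrite big_split /= gU ?gV ?addr0.
Qed.

(** If [v] is orthogonal to the orthogonal of [V], let [r] be a projection with
    kernel [V].  Each coordinate of [r] is a functional killing [V], hence is
    pairing with a vector of the orthogonal of [V]; so [r v = 0] and [v \in V]. *)
Lemma vperpK X V : (V <= vfull F X)%VS -> vperp X (vperp X V) = V.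
Proof.
move=> sVX; apply/vspaceP=> v; apply/vperpP/idP => [[vX orth] | vV]; last first.
  split=> [|g /vperpP[_ gV]]; first exact: (subvP sVX).
  by rewrite -[RHS](gV v vV); apply: eq_bigr => e _; rewrite mulrC.
pose r f := f - projv V f.
have rE f x : r f x = \sum_e f e * r (unitv e) x.
  rewrite {1}[f]vec_unitv /r linear_sum -sumrB sum_ffunE; apply: eq_bigr => e _.
  by rewrite linearZ /= -scalerBr ffunE.
suff rv : r v = 0 by rewrite -[v](subrK (projv V v)) [_ - _]rv add0r memv_proj.
apply/ffunP=> x; rewrite [RHS]ffunE rE.
pose g : vec := [ffun e => if e \in X then r (unitv e) x else 0].
have gE f : f \in vfull F X -> \sum_(e in X) g e * f e = r f x.
  move=> /vfullP f0; rewrite rE big_mkcond; apply: eq_bigr => e _.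
  by rewrite ffunE; case: (boolP (e \in X)) => [_|/f0 ->]; rewrite ?mul0r // mulrC.
rewrite -rE -gE //; apply: orth; apply/vperpP; split=> [|f fV].
  by apply/vfullP=> e /negPf eX; rewrite ffunE eX.
transitivity (r f x); last by rewrite /r projv_id // subrr ffunE.
by rewrite -gE ?(subvP sVX) //; apply: eq_bigr => e _; rewrite mulrC.
Qed.

(** Contraction and restriction are exchanged by orthogonality: together with
    [vperp_vres], this says that the orthogonal in [S] of the restriction of [V]
    to [S] is the contraction to [S] of the orthogonal of [V]. *)
Lemma vcontr_vperp X S V : S \subset X -> vcontr S (vperp X V) = vperp S V.
Proof.
move=> sSX; apply/vspaceP=> g; rewrite mem_vcontr.
have sumS f : g \in vfull F S ->
    \sum_(e in X) f e * g e = \sum_(e in S) f e * g e.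
  move=> /vfullP g0; rewrite (big_setID S) /= (setIidPr sSX) [X in _ + X]big1 ?addr0 //.
  by move=> e; rewrite inE => /andP[/g0 -> _]; rewrite mulr0.
apply/andP/vperpP => [[/vperpP[_ gV] gS] | [gS gV]].
  by split=> // f /gV; rewrite sumS.
split=> //; apply/vperpP; split=> [|f /gV]; last by rewrite sumS.
exact: (subvP (vfullS sSX)).
Qed.

Lemma vperp_vres S X V : X \subset S -> vperp X (vres S V) = vperp X V.
Proof.
move=> sXS; apply/vspaceP=> g; have restrE f :
    \sum_(e in X) vrestr F S f e * g e = \sum_(e in X) f e * g e.
  by apply: eq_bigr => e eX; rewrite vrestrE (subsetP sXS).
apply/vperpP/vperpP => -[gX gV]; split=> //.
  by move=> f fV; rewrite -restrE gV // memv_img.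
by move=> _ /memv_imgP[f fV ->]; rewrite restrE gV.
Qed.

Lemma vres_sub S V : (vres S V <= vfull F S)%VS.
Proof. by apply/subvP=> _ /memv_imgP[f _ ->]; apply: vrestr_full. Qed.

Lemma vperp_setU X Y V : [disjoint X & Y] -> (V <= vfull F X)%VS ->
  vperp (X :|: Y) V = (vperp X V + vfull F Y)%VS.
Proof.
move=> dXY sVX.
have sumX f g : f \in V -> \sum_(e in X :|: Y) f e * g e = \sum_(e in X) f e * g e.
  move=> /(subvP sVX)/vfullP f0; rewrite (big_setID X) /= setUK [X in _ + X]big1 ?addr0 //.
  by move=> e; rewrite inE => /andP[/f0 -> _]; rewrite mul0r.
apply/vspaceP=> g; apply/vperpP/memv_addP.
  move=> [/vfullP g0 gV]; exists (vrestr F X g).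
    apply/vperpP; split=> [|f fV]; first exact: vrestr_full.
    rewrite -[RHS](gV f fV) sumX //; apply: eq_bigr => e eX.
    by rewrite vrestrE eX.
  exists (vrestr F Y g); first exact: vrestr_full.
  apply/ffunP=> e; rewrite ffunE !vrestrE; case: ifPn => eX.
    by rewrite (disjointFr dXY eX) addr0.
  by case: ifPn => eY; rewrite add0r // g0 // inE negb_or eX.
case=> [h /vperpP[hX hV]] [k kY ->]; split=> [|f fV].
  apply: memvD; [move: h hX {hV} | move: k kY]; apply/subvP; apply: vfullS.
    exact: subsetUl.
  exact: subsetUr.
rewrite sumX // -[RHS](hV f fV); apply: eq_bigr => e eX.
by rewrite ffunE (vfullP _ _ kY e) ?addr0 // (disjointFr dXY eX).
Qed.

(** A linear dependence between the columns indexed by [I] is a vector supported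
    in [I] and orthogonal to the rows, which span [V]. *)
Lemma col_freeE V I : col_free V I = (vperp I V == 0%VS).
Proof.
rewrite /col_free.
have colE g : \sum_(e in I) g e *: vcol V e = 0 <->
    (forall f, f \in V -> \sum_(e in I) f e * g e = 0).
  split=> [g0 f fV | orth].
    transitivity (\sum_i coord (vbasis V) i f * (\sum_(e in I) g e *: vcol V e) i 0).
      under [RHS]eq_bigr => i _ do rewrite summxE mulr_sumr.
      rewrite exchange_big; apply: eq_bigr => e _ /=.
      rewrite {1}(coord_vbasis fV) sum_ffunE mulr_suml; apply: eq_bigr => i _.
      by rewrite !ffunE !mxE -mulrA [g e * _]mulrC.
    by rewrite g0 big1 // => i _; rewrite mxE mulr0.
  apply/colP=> i; rewrite mxE summxE.
  rewrite -[RHS](orth (vbasis V)`_i) ?vbasis_mem ?mem_nth ?size_tuple //.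
  by apply: eq_bigr => e _; rewrite !mxE mulrC.
pose X := [tuple of [seq vcol V e | e <- enum_tuple I]].
rewrite -[[seq _ | _ <- _]]/(tval X).
apply/(freeP (X := X))/vspace0P => [fr g /vperpP[gI /colE g0] | z k k0 i].
  have kg0 : forall i : 'I_#|I|, g (enum_val i) = 0.
    apply: fr; rewrite -[RHS]g0 [RHS]big_enum_val; apply: eq_bigr => i _.
    by rewrite (nth_map (enum_val i)) -?cardE // -enum_val_nth.
  apply/ffunP=> e; rewrite [RHS]ffunE; case: (boolP (e \in I)) => [eI|].
    by rewrite -(enum_rankK_in eI eI) kg0.
  exact: (vfullP _ _ gI).
pose g : vec := [ffun e => if insub (index e (enum I)) is Some j then k j else 0].
have gE (j : 'I_#|I|) : g (enum_val j) = k j.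
  rewrite ffunE; have ej : index (enum_val j) (enum I) = j.
    by rewrite (enum_val_nth (enum_val j)) index_uniq ?enum_uniq // -cardE.
  by case: insubP => [l _ el|]; [congr k; apply: val_inj; rewrite /= el ej | rewrite ej ltn_ord].
rewrite -gE (z g) ?ffunE //; apply/vperpP; split.
  apply/vfullP=> e eI; rewrite ffunE insubF //.
  by apply/negbTE; rewrite -leqNgt cardE leqNgt index_mem mem_enum.
apply/colE; rewrite -[RHS]k0 big_enum_val; apply: eq_bigr => j _.
by rewrite gE (nth_map (enum_val j)) -?cardE // -enum_val_nth.
Qed.

Lemma col_free_vres V I : col_free V I = (vres I V == vfull F I).
Proof.
rewrite col_freeE -(vperp_vres (S := I)) //; apply/eqP/eqP => [e | ->].
  rewrite -[LHS](vperpK (vres_sub I V)) e; apply/vspaceP=> g.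
  apply/vperpP/idP=> [[] // | gI]; split=> // f; rewrite memv0 => /eqP->.
  by rewrite big1 // => x _; rewrite ffunE mul0r.
apply/eqP/vspace0P=> g /vperpP[/vfullP g0 gI]; apply/ffunP=> x; rewrite [RHS]ffunE.
case: (boolP (x \in I)) => [xI|/g0 //].
rewrite -[RHS](gI _ (unitv_full xI)) (bigD1 x) //= big1 => [|e /andP[_ /negPf ne]].
  by rewrite ffunE eqxx mul1r addr0.
by rewrite ffunE ne mul0r.
Qed.

Lemma indep_vmatroid X V I : indep (vmatroid X V) I = (I \subset X) && col_free V I.
Proof.
rewrite /indep /= sub_maximals ?inE // => J K.
rewrite !inE => /andP[sK fK] sJK.
by rewrite (subset_trans sJK sK) (col_freeS sJK fK).
Qed.

(** This form is visibly symmetric under [V -> vperp X V], [b -> X :\: b].  By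
    [col_freeE] and [vperpK] its last condition says that no nonzero [v \in V] is supported
    off [b]: such a [v], nonzero at [y], would make [y |: b] independent, and
    conversely if [b] grew by [y] to an independent [t] then [V] would contain
    a vector restricting on [t] to the unit vector of [y]. *)
Lemma vmatroid_basisP X V (b : {set T}) : (V <= vfull F X)%VS ->
  reflect [/\ b \subset X, col_free V b & col_free (vperp X V) (X :\: b)]
          (b \in bases (vmatroid X V)).
Proof.
move=> sVX.
have coE : col_free (vperp X V) (X :\: b) = (vcontr (X :\: b) V == 0%VS).
  by rewrite col_freeE -(vcontr_vperp _ (subsetDl X b)) vperpK.
rewrite coE inE; apply: (iffP maxsetP) => [[] | [sb fb /vspace0P z]].
  rewrite inE => /andP[sb fb] m; split=> //; apply/vspace0P=> v.
  rewrite mem_vcontr => /andP[vV /vfullP v0]; apply/ffunP=> y; rewrite [RHS]ffunE.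
  apply/eqP; apply: contraT => vy.
  have : y \in X :\: b by apply: contraR vy => /v0 ->.
  rewrite inE => /andP[yb yX].
  (* The equation given by [v] kills the coefficient of [y] in a dependence. *)
  suff /m e : y |: b \in [set I : {set T} | (I \subset X) && col_free V I].
    by move: yb; rewrite -e ?setU11 ?subsetUr.
  rewrite inE subUset sub1set yX sb col_freeE /=.
  apply/vspace0P=> g /vperpP[/vfullP g0 gV].
  have gy : g y = 0.
    have := gV v vV; rewrite (bigD1 y) ?setU11 //= big1 ?addr0.
      by move/eqP; rewrite mulf_eq0 (negPf vy) => /eqP.
    move=> e; rewrite !inE => /andP[/orP[->//|eb] _].
    by rewrite v0 ?mul0r // inE eb.
  have gI : g \in vfull F b.
    apply/vfullP=> e eb; have [->//|ne] := eqVneq e y.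
    by apply: g0; rewrite !inE negb_or ne.
  move: fb; rewrite col_freeE => /vspace0P; apply; apply/vperpP; split=> // f fV.
  by rewrite -[RHS](gV f fV) [RHS]big_setU1 //= gy mulr0 add0r.
split; first by rewrite inE sb.
move=> t; rewrite inE => /andP[tX tf] sbt.
apply/eqP; rewrite eqEsubset sbt andbT; apply/subsetP=> y yt; apply: contraT => yb.
have := unitv_full yt; move: tf; rewrite col_free_vres => /eqP <-.
case/memv_imgP=> v vV /ffunP ev; have {}ev e : e \in t -> v e = (e == y)%:R.
  by move=> et; have := ev e; rewrite vrestrE et ffunE.
suff v0 : v = 0 by have /eqP := ev y yt; rewrite v0 ffunE eqxx eq_sym oner_eq0.
apply: z; rewrite mem_vcontr vV; apply/vfullP=> e; rewrite inE negb_and negbK.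
case/orP=> [eb | eX]; last by apply: (vfullP _ _ (subvP sVX _ vV)).
rewrite ev ?(subsetP sbt) //; case: eqP eb => // ->; by rewrite (negPf yb).
Qed.

Lemma mdual_vmatroid X V : (V <= vfull F X)%VS ->
  mdual (vmatroid X V) = vmatroid X (vperp X V).
Proof.
move=> sVX; have sP := vperp_sub X V.
have perpE := vmatroid_basisP _ sP; rewrite (vperpK sVX) in perpE.
apply: matroid_eq => //; apply/setP=> s; apply/imsetP/perpE.
  case=> b /(vmatroid_basisP _ sVX)[sb fb fc] -> /=.
  by rewrite setDDK ?subsetDl.
case=> ss fs fc; exists (X :\: s) => /=; last by rewrite setDDK.
by apply/(vmatroid_basisP _ sVX); rewrite setDDK ?subsetDl.
Qed.

Lemma mrestr_vmatroid X S V : S \subset X ->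
  mrestr (vmatroid X V) S = vmatroid S (vres S V).
Proof.
move=> sSX; apply: matroid_indep_eq => // I.
rewrite indep_mrestr !indep_vmatroid; case: (boolP (I \subset S)) => //= sIS.
by rewrite (subset_trans sIS sSX) !col_freeE vperp_vres.
Qed.

Lemma mcontr_vmatroid X S V : S \subset X -> (V <= vfull F X)%VS ->
  mcontr (vmatroid X V) S = vmatroid S (vcontr S V).
Proof.
move=> sSX sVX; rewrite /mcontr mdual_vmatroid // mrestr_vmatroid //.
by rewrite mdual_vmatroid ?vres_sub // vperp_vres // -(vcontr_vperp _ sSX) vperpK.
Qed.

(** Scaling the columns by nonzero scalars preserves their dependences up to
    inverse scaling of the coefficients. *)
Lemma vmatroid_scale X V W (c : T -> F) : (forall e, c e != 0) ->
  (forall f, (f \in W) = ([ffun e => c e * f e] \in V)) ->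
  vmatroid X W = vmatroid X V.
Proof.
move=> c0 WV; apply: matroid_indep_eq => // I; rewrite !indep_vmatroid !col_freeE.
congr (_ && _); apply/vspace0P/vspace0P => z g /vperpP[/vfullP g0 gV].
  have cg : [ffun e => c e * g e] = 0 :> vec.
    apply: z; apply/vperpP; split; first by apply/vfullP=> e eI; rewrite ffunE g0 ?mulr0.
    move=> f; rewrite WV => /gV cf0; rewrite -[RHS]cf0; apply: eq_bigr => e _.
    by rewrite !ffunE mulrCA mulrA.
  apply/ffunP=> e; have /ffunP/(_ e)/eqP := cg.
  by rewrite !ffunE mulf_eq0 (negPf (c0 e)) => /eqP.
have cg : [ffun e => (c e)^-1 * g e] = 0 :> vec.
  apply: z; apply/vperpP; split; first by apply/vfullP=> e eI; rewrite ffunE g0 ?mulr0.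
  move=> f fV; rewrite -[RHS](gV [ffun e => (c e)^-1 * f e]).
    by apply: eq_bigr => e _; rewrite !ffunE mulrCA mulrA.
  rewrite WV; suff -> : [ffun e => c e * [ffun e0 => (c e0)^-1 * f e0] e] = f by [].
  by apply/ffunP=> e; rewrite !ffunE mulVKf.
apply/ffunP=> e; have /ffunP/(_ e)/eqP := cg.
by rewrite !ffunE mulf_eq0 invr_eq0 (negPf (c0 e)) => /eqP.
Qed.

(** The set [a] is found greedily.  At each stage the elements of [D] have been
    decided, those of [a] being required zeros of [q \in Q] and the other ones
    required zeros of [p \in P]; the invariant is that [p] and [q] with these
    zeros and equal off [D] must vanish.  A further element [e] can be put on
    one of the two sides: if both choices failed, with witnesses [p, q] and
    [p', q'], then the combination with coefficients [q' e] and [p e] would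
    agree at [e] as well, contradicting the invariant for [D]. *)
Lemma disjoint_split P Q : (P :&: Q)%VS = 0%VS ->
  exists a : {set T}, vcontr a P = 0%VS /\ vcontr (~: a) Q = 0%VS.
Proof.
move=> PQ0.
pose inv (D a : {set T}) := forall p q, p \in P -> q \in Q ->
  {in a, q =1 fun=> 0} -> {in D :\: a, p =1 fun=> 0} -> {in ~: D, p =1 q} ->
  p = 0 /\ q = 0.
have grow n : (n <= #|T|)%N -> exists D a : {set T}, [/\ #|D| = n, a \subset D & inv D a].
  elim: n => [_|n IHn lt]; last first.
    have [D [a [cD sa iD]]] := IHn (ltnW lt).
    have [e eD] : exists e, e \notin D.
      apply/existsP; rewrite -negb_forall; apply: contraL lt => /forallP al.
      have -> : #|T| = #|D| by rewrite -cardsT; apply: eq_card => x; rewrite inE al.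
      by rewrite cD ltnn.
    have ea : e \notin a by apply: contra eD; apply: (subsetP sa).
    exists (e |: D); have cD' : #|e |: D| = n.+1 by rewrite cardsU1 eD cD.
    case: (classic (inv (e |: D) (e |: a))) => [i1 | n1].
      by exists (e |: a); rewrite setUS.
    exists a; split=> //; first exact: subset_trans sa (subsetUr _ _).
    move=> p' q' pP' qQ' qa' pd' pq'.
    have pe' : p' e = 0 by apply: pd'; rewrite !inE eqxx ea.
    have pD' : {in D :\: a, p' =1 fun=> 0}.
      by move=> x; rewrite inE => /andP[xa xD]; apply: pd'; rewrite !inE xa xD orbT.
    have [qe'|qe'] := eqVneq (q' e) 0.
      apply: iD => // x; rewrite inE => xD; have [->|ne] := eqVneq x e.
        by rewrite pe' qe'.
      by apply: pq'; rewrite !inE negb_or ne.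
    case: n1 => p q pP qQ qa pd pq.
    have qe : q e = 0 by apply: qa; rewrite setU11.
    have qA : {in a, q =1 fun=> 0} by move=> x xa; apply: qa; rewrite inE xa orbT.
    have pD : {in D :\: a, p =1 fun=> 0}.
      move=> x; rewrite inE => /andP[xa xD]; apply: pd.
      by rewrite !inE negb_or xa xD orbT !andbT; apply: contraNneq eD => <-.
    suff pe : p e = 0.
      apply: iD => // x; rewrite inE => xD; have [->|ne] := eqVneq x e.
        by rewrite pe qe.
      by apply: pq; rewrite !inE negb_or ne.
    (* These coefficients give both combinations the value [q' e * p e] at [e]. *)
    have [|||||pp0 _] := iD (q' e *: p + p e *: p') (q' e *: q + p e *: q').
    - by rewrite memvD ?memvZ.
    - by rewrite memvD ?memvZ.
    - by move=> x xa; rewrite !ffunE (qA x xa) (qa' x xa) !scaler0 addr0.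
    - by move=> x xd; rewrite !ffunE (pD x xd) (pD' x xd) !scaler0 addr0.
    - move=> x; rewrite inE => xD; rewrite !ffunE; have [->|ne] := eqVneq x e.
        by rewrite qe pe' !scaler0 add0r addr0 [LHS]mulrC.
      have xE : x \in ~: (e |: D) by rewrite !inE negb_or ne.
      by rewrite (pq x xE) (pq' x xE).
    have /ffunP/(_ e)/eqP := pp0; rewrite !ffunE pe' scaler0 addr0.
    by rewrite [_ *: _]/(_ * _) mulf_eq0 (negPf qe') => /eqP.
  exists set0, set0; split; rewrite ?cards0 // => p q pP qQ _ _ pq.
  have epq : p = q by apply/ffunP=> x; apply: pq; rewrite !inE.
  suff p0 : p = 0 by rewrite -epq.
  by apply/eqP; rewrite -memv0 -PQ0 memv_cap pP epq.
have [D [a [cD _ iD]]] := grow #|T| (leqnn _).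
have {cD} DT x : x \in D.
  by have /eqP-> : D == setT; rewrite ?inE // eqEcard subsetT cardsT cD /=.
have nD (f g : vec) : {in ~: D, f =1 g} by move=> x; rewrite inE DT.
exists a; split; apply/eqP/vspace0P=> f; rewrite mem_vcontr => /andP[fW /vfullP f0].
  have [||-> _] // := iD f 0 fW (mem0v _) _ _ (nD _ _) => //.
    by move=> x _; rewrite ffunE.
  by move=> x; rewrite inE => /andP[xa _]; apply: f0.
have [||_ ->] // := iD 0 f (mem0v _) fW _ _ (nD _ _) => //.
  by move=> x xa; apply: f0; rewrite inE xa.
by move=> x _; rewrite ffunE.
Qed.

(** Apply [disjoint_split] to the vectors supported in [I] and orthogonal to [U],
    respectively to [V]: no nonzero vector belongs to both spaces. *)
Lemma col_free_split U V I : col_free (U + V)%VS I ->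
  exists J K, [/\ col_free U J, col_free V K & J :|: K = I].
Proof.
rewrite col_freeE vperpD => /eqP/disjoint_split[a [za zc]].
exists (I :&: a), (I :\: a); rewrite setID !col_freeE.
rewrite -(vcontr_vperp U (subsetIl I a)) -(vcontr_vperp V (subsetDl I a)).
split=> //; apply/vspace0P=> f; rewrite mem_vcontr => /andP[fP fI]; apply/eqP.
  rewrite -memv0 -za mem_vcontr fP; apply: subvP fI; apply: vfullS; exact: subsetIr.
rewrite -memv0 -zc mem_vcontr fP; apply: subvP fI; apply: vfullS.
by apply/subsetP=> x; rewrite !inE => /andP[].
Qed.

(** The intersection of the contractions to [B] is, by [vcontr_vperp], the space
    of vectors on [B] orthogonal to both orthogonal spaces; it vanishes iff [B]
    is independent for their sum. *)
Lemma vrigidP X Y B U V : B \subset X -> B \subset Y ->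
  (U <= vfull F X)%VS -> (V <= vfull F Y)%VS ->
  vrigid B U V <->
  B = set0 \/ col_free (U + V)%VS B /\ col_free (vperp X U + vperp Y V)%VS B.
Proof.
move=> sBX sBY sU sV; rewrite /vrigid col_free_vres /vres limgD.
rewrite col_freeE vperpD -(vcontr_vperp _ sBX) -(vcontr_vperp _ sBY) !vperpK //.
by split=> -[-> | [e1 e2]]; [left | right | left | right];
  split=> //; apply/eqP.
Qed.

Lemma vinter_vperp A B C U V :
  [disjoint A & B] -> [disjoint B & C] -> [disjoint A & C] ->
  (U <= vfull F (A :|: B))%VS -> (V <= vfull F (B :|: C))%VS ->
  vinter A C (vperp (A :|: B) U) (vperp (B :|: C) V) =
  vperp (A :|: B :|: C) (U + V)%VS.
Proof.
move=> dAB dBC dAC sU sV; rewrite vperpD.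
have dU : [disjoint A :|: B & C] by rewrite -setI_eq0 setIUl !disjoint_setI0 ?setU0.
have dV : [disjoint B :|: C & A].
  by rewrite disjoint_sym -setI_eq0 setIUr !disjoint_setI0 ?setU0.
rewrite [in RHS](vperp_setU dU sU) -setUA [A :|: (B :|: C)]setUC (vperp_setU dV sV).
by rewrite /vinter [(vperp (B :|: C) V + _)%VS]addvC.
Qed.

(** A vector [f + g] of the matching comes from [f + h \in U] and [h + g \in V];
    their difference [f - g] lies in the contraction of [U + V], and every
    vector of the contraction arises so.  The sign on [C] is immaterial. *)
Lemma vmatroid_vmatch A B C U V :
  [disjoint A & B] -> [disjoint B & C] -> [disjoint A & C] ->
  (U <= vfull F (A :|: B))%VS -> (V <= vfull F (B :|: C))%VS ->
  vmatroid (A :|: C) (vmatch A C U V) =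
  vmatroid (A :|: C) (vcontr (A :|: C) (U + V)%VS).
Proof.
move=> dAB dBC dAC sU sV.
(* This scaling of coordinates turns [f + g] into [f - g]. *)
pose c e : F := if e \in C then -1 else 1.
apply: (@vmatroid_scale _ _ _ c) => [e | k].
  by rewrite /c; case: ifP; rewrite ?oppr_eq0 oner_eq0.
rewrite mem_vcontr; apply/(vmatchP _ dAB dBC dAC sU sV)/andP.
  case=> f [g [h [[fA hB gC] [fhU hgV ->]]]].
  have -> : [ffun e => c e * (f + g) e] = (f + h) - (h + g).
    apply/ffunP=> e; rewrite !ffunE /c opprD addrA addrK.
    case: ifPn => eC; first by rewrite (vfullP _ _ fA) ?(disjointFl dAC eC) // !add0r mulN1r.
    by rewrite (vfullP _ _ gC) // oppr0 !addr0 mul1r.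
  split; first by rewrite memv_add ?memvN.
  have -> : f + h - (h + g) = f - g by rewrite opprD addrA addrK.
  apply: memvB; first exact: subvP (vfullS (subsetUl A C)) _ fA.
  exact: subvP (vfullS (subsetUr A C)) _ gC.
case=> /memv_addP[u uU [v vV /ffunP kE]] /vfullP k0.
have {}kE e : c e * k e = u e + v e by have := kE e; rewrite !ffunE.
have {}k0 e : e \in B -> u e + v e = 0.
  move=> eB; have := k0 e; rewrite ffunE kE; apply.
  by rewrite inE negb_or (disjointFl dAB eB) (disjointFr dBC eB).
have u0 := vfullP _ _ (subvP sU _ uU); have v0 := vfullP _ _ (subvP sV _ vV).
(* The component on [B] is that of [u], which is opposite to that of [v]. *)
exists (vrestr F A u), (- vrestr F C v), (vrestr F B u).
split; first by rewrite memvN !vrestr_full.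
split.
- suff -> : vrestr F A u + vrestr F B u = u by [].
  apply/ffunP=> z; rewrite ffunE !vrestrE.
  case: ifPn => zA; first by rewrite (disjointFr dAB zA) addr0.
  by case: ifPn => zB; rewrite add0r // u0 // inE negb_or zA.
- suff -> : vrestr F B u - vrestr F C v = - v by rewrite memvN.
  apply/ffunP=> z; rewrite !ffunE !vrestrE.
  case: ifPn => zB.
    by rewrite (disjointFr dBC zB) subr0; apply/eqP; rewrite -addr_eq0 k0.
  by case: ifPn => zC; rewrite add0r // v0 // inE negb_or zB.
apply/ffunP=> z; rewrite !ffunE !vrestrE.
have := kE z; rewrite /c; case: ifPn => zC.
  rewrite u0 ?inE ?(disjointFl dAC zC) ?(disjointFl dBC zC) // !add0r => <-.
  by rewrite mulN1r opprK.
rewrite mul1r subr0 => ->; case: ifPn => zA.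
  by rewrite v0 ?addr0 // inE negb_or zC andbT (disjointFr dAB zA).
have [/k0 //|zB] := boolP (z \in B).
by rewrite u0 ?v0 ?addr0 // !inE negb_or ?zB ?zA ?zC.
Qed.

Lemma indep_mvee_vmatroid X Y U V I : I \subset X -> I \subset Y ->
  col_free (U + V)%VS I -> indep (mvee (vmatroid X U) (vmatroid Y V)) I.
Proof.
move=> sIX sIY /col_free_split[J [K [fJ fK eI]]]; apply/indep_mveeP.
exists J, K; rewrite !indep_vmatroid fJ fK eI !andbT; split=> //.
  by apply: subset_trans sIX; rewrite -eI subsetUl.
by apply: subset_trans sIY; rewrite -eI subsetUr.
Qed.

End SpaceFacts.

Theorem theorem56 (F : fieldType) (T : finType) (A B C : {set T})
    (VAB VBC : {vspace {ffun T -> F^o}})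
    (dAB : [disjoint A & B]) (dBC : [disjoint B & C]) (dAC : [disjoint A & C])
    (hAB : (VAB <= vfull F (A :|: B))%VS)
    (hBC : (VBC <= vfull F (B :|: C))%VS) :
  let AB := A :|: B in
  let BC := B :|: C in
  let ABC := A :|: B :|: C in
  let MAB := vmatroid AB VAB in
  let MBC := vmatroid BC VBC in
  let VABp := vperp AB VAB in
  let VBCp := vperp BC VBC in
  (vrigid B VAB VBC -> mrigid B MAB MBC)
  /\
  (vmatroid ABC (VAB + VBC)%VS = mvee MAB MBC ->
   vmatroid ABC (VABp + VBCp)%VS = mvee (vmatroid AB VABp) (vmatroid BC VBCp) ->
   [/\ vmatroid ABC (vinter A C VAB VBC) = mwedge MAB MBC /\
       vmatroid ABC (vinter A C VABp VBCp) = mwedge (mdual MAB) (mdual MBC),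
       vmatroid (A :|: C) (vmatch A C VAB VBC) = mmatch MAB MBC
     & vrigid B VAB VBC <-> mrigid B MAB MBC]).
Proof.
move=> AB BC ABC MAB MBC VABp VBCp.
have sB_AB : B \subset AB by apply: subsetUr.
have sB_BC : B \subset BC by apply: subsetUl.
have sAB : AB \subset ABC by apply: subsetUl.
have sBC : BC \subset ABC by rewrite /ABC -setUA subsetUr.
have sABp : (VABp <= vfull F AB)%VS := vperp_sub AB VAB.
have sBCp : (VBCp <= vfull F BC)%VS := vperp_sub BC VBC.
have dMAB : mdual MAB = vmatroid AB VABp := mdual_vmatroid hAB.
have dMBC : mdual MBC = vmatroid BC VBCp := mdual_vmatroid hBC.
have sumS (U V : {vspace {ffun T -> F^o}}) : (U <= vfull F AB)%VS ->
    (V <= vfull F BC)%VS -> (U + V <= vfull F ABC)%VS.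
  move=> sU sV; rewrite subv_add; apply/andP; split.
    exact: subv_trans sU (vfullS F sAB).
  exact: subv_trans sV (vfullS F sBC).
have vrigidE := vrigidP sB_AB sB_BC hAB hBC.
have v2m : vrigid B VAB VBC -> mrigid B MAB MBC.
  rewrite vrigidE mrigidP dMAB dMBC => -[-> | [fV fVp]]; [by left | right].
  by split; apply: indep_mvee_vmatroid.
split=> // e ep; split; last first.
- split=> //; rewrite vrigidE mrigidP dMAB dMBC -e -ep.
  by rewrite !indep_vmatroid => -[-> | [/andP[_ fV] /andP[_ fVp]]]; [left | right].
- rewrite (vmatroid_vmatch dAB dBC dAC hAB hBC) /mmatch -e.
  have -> : ground MAB :\: ground MBC :|: ground MBC :\: ground MAB = A :|: C.
    apply/setP=> x; rewrite !inE.
    have [xA|_] := boolP (x \in A); first by rewrite (disjointFr dAB xA) (disjointFr dAC xA).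
    by have [xB|_] := boolP (x \in B); rewrite /= ?(disjointFr dBC xB) ?andbF ?andbT ?orbF.
  rewrite mcontr_vmatroid ?sumS //.
  by apply/subsetP=> x; rewrite !inE => /orP[->|->]; rewrite ?orbT.
split.
  rewrite -[MAB]mdualK -[MBC]mdualK -mdual_mvee dMAB dMBC -ep.
  rewrite mdual_vmatroid ?sumS // -(vinter_vperp dAB dBC dAC sABp sBCp).
  by rewrite /VABp /VBCp !vperpK.
by rewrite -mdual_mvee -e (mdual_vmatroid (sumS _ _ hAB hBC)) (vinter_vperp dAB dBC dAC hAB hBC).
Qed.
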